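(* For all integers $n\ge 0$, $$\tilde{F}_{n+1}(y)=(-y)^n\,{}_2F_1\left(\frac{1}{2}-\frac{n}{2},\, -\frac{n}{2};\, 2;\, -\frac{4}{y}\right).$$
   Context: Let $u(x)$ be the unique formal power series in $x$ with coefficients in $\mathbb{Q}[y]$ such that $u(0)=0$ and $\frac{u}{1-yu-yu^2}=x$; explicitly $\frac{u}{x}=\frac{\sqrt{1+2yx+y(y+4)x^2}-yx-1}{2yx^2}$. The polynomials $\tilde F_n(y)$, $n\ge0$, are defined by $\sum_{n\ge 0}\tilde F_n(y)x^n=u(x)$ (so $\tilde F_0=0$, $\tilde F_1=1$, $\tilde F_2=-y$, $\tilde F_3=y^2-y$, $\tilde F_4=-y^3+3y^2$). ${}_2F_1(\alpha,\beta;\gamma;z)=\sum_{j\ge0}\frac{(\alpha)_j(\beta)_j}{(\gamma)_j\,j!}z^j$ is the Gauss hypergeometric series, where $(\alpha)_j=\alpha(\alpha+1)\cdots(\alpha+j-1)$; for the parameters used here the series terminates, and the identity is one in $\mathbb{Q}[y,y^{-1}]$. *)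

(* Defs.v *)
From HB Require Import structures.
From mathcomp Require Import all_boot all_order all_algebra.
From mathcomp Require Import boolp classical_sets fsbigop.

Set Implicit Arguments.
Unset Strict Implicit.
Unset Printing Implicit Defensive.

Import GRing.Theory.
Local Open Scope ring_scope.

Record fps (R : Type) := FPS { fps_coef : nat -> R }.

Definition fpsn (R : Type) (a : fps R) (n : nat) : R := fps_coef a n.
Arguments fpsn : simpl never.

Notation "a .[^ n ]" := (fpsn a n)
  (at level 1, left associativity, format "a .[^ n ]") : ring_scope.

Lemma fpsP (R : Type) (a b : fps R) : (forall n, a.[^n] = b.[^n]) -> a = b.
Proof. by case: a b => [a] [b] /= ab; congr FPS; exact/funext. Qed.

HB.instance Definition _ (R : Type) := gen_eqMixin (fps R).
HB.instance Definition _ (R : Type) := gen_choiceMixin (fps R).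

Section FpsZmod.
Context {R : zmodType}.
Implicit Types a b c : fps R.

Definition fps_zero : fps R := FPS (fun=> 0).
Definition fps_opp a : fps R := FPS (fun n => - a.[^n]).
Definition fps_add a b : fps R := FPS (fun n => a.[^n] + b.[^n]).

Fact fps_addA : associative fps_add.
Proof. by move=> a b c; apply: fpsP => n; exact: addrA. Qed.
Fact fps_addC : commutative fps_add.
Proof. by move=> a b; apply: fpsP => n; exact: addrC. Qed.
Fact fps_add0 : left_id fps_zero fps_add.
Proof. by move=> a; apply: fpsP => n; exact: add0r. Qed.
Fact fps_addN : left_inverse fps_zero fps_opp fps_add.
Proof. by move=> a; apply: fpsP => n; exact: addNr. Qed.

HB.instance Definition _ :=
  GRing.isZmodule.Build (fps R) fps_addA fps_addC fps_add0 fps_addN.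

Lemma fpsn0 n : (0 : fps R).[^n] = 0. Proof. by []. Qed.
Lemma fpsnN a n : (- a).[^n] = - a.[^n]. Proof. by []. Qed.
Lemma fpsnD a b n : (a + b).[^n] = a.[^n] + b.[^n]. Proof. by []. Qed.
Lemma fpsnB a b n : (a - b).[^n] = a.[^n] - b.[^n]. Proof. by []. Qed.

End FpsZmod.

Section FpsRing.
Context {R : comNzRingType}.
Implicit Types a b c : fps R.

Definition fpsC (r : R) : fps R := FPS (fun n => if n == 0%N then r else 0).
Definition fpsX : fps R := FPS (fun n => (n == 1%N)%:R).
Definition fps_mul a b : fps R :=
  FPS (fun n => \sum_(i < n.+1) a.[^i] * b.[^(n - i)%N]).

Let trunc N a : {poly R} := \poly_(i < N.+1) a.[^i].

Let truncE N a n : (n <= N)%N -> (trunc N a)`_n = a.[^n].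
Proof. by move=> nN; rewrite coef_poly ltnS nN. Qed.

Let fps_mul_trunc N a b n : (n <= N)%N ->
  (fps_mul a b).[^n] = (trunc N a * trunc N b)`_n.
Proof.
move=> nN; rewrite coefM; apply: eq_bigr => i _.
rewrite !truncE //; first exact: leq_trans (leq_subr _ _) nN.
by apply: leq_trans nN; rewrite -ltnS.
Qed.

Fact fps_mulC : commutative fps_mul.
Proof.
by move=> a b; apply: fpsP => n; rewrite !(fps_mul_trunc _ _ (leqnn n)) mulrC.
Qed.

Let fps_mulE3 a b c n : (fps_mul a (fps_mul b c)).[^n] =
  (trunc n a * (trunc n b * trunc n c))`_n.
Proof.
rewrite coefM; apply: eq_bigr => i _.
have /truncE-> : (i <= n)%N by rewrite -ltnS.
by rewrite (@fps_mul_trunc n) ?leq_subr.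
Qed.

Fact fps_mulA : associative fps_mul.
Proof.
move=> a b c; apply: fpsP => n.
by rewrite [fps_mul (fps_mul _ _) _]fps_mulC !fps_mulE3 mulrA mulrC.
Qed.

Fact fps_mul1 : left_id (fpsC 1) fps_mul.
Proof.
move=> a; apply: fpsP => n.
rewrite /fpsn /= -/(fpsn _ _) big_ord_recl /= {1}/fpsn /= mul1r subn0.
by rewrite big1 ?addr0 // => i _; rewrite {1}/fpsn /= mul0r.
Qed.

Fact fps_mulDl : left_distributive fps_mul +%R.
Proof.
move=> a b c; apply: fpsP => n; rewrite fpsnD -big_split /=.
by apply: eq_bigr => i _; rewrite -mulrDl.
Qed.

Fact fps_one_neq0 : fpsC 1 != 0.
Proof.
apply/eqP => /(congr1 (fun a : fps R => a.[^0])) /eqP.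
by rewrite fpsn0 /fpsn /= oner_eq0.
Qed.

HB.instance Definition _ := GRing.Zmodule_isComNzRing.Build (fps R)
  fps_mulA fps_mulC fps_mul1 fps_mulDl fps_one_neq0.

Lemma fpsnM a b n : (a * b).[^n] = \sum_(i < n.+1) a.[^i] * b.[^(n - i)%N].
Proof. by []. Qed.
Lemma fpsn1 n : (1 : fps R).[^n] = (n == 0%N)%:R.
Proof. by rewrite /fpsn /=; case: n. Qed.
Lemma fpsnC r n : (fpsC r).[^n] = if n == 0%N then r else 0.
Proof. by []. Qed.
Lemma fpsnX n : fpsX.[^n] = (n == 1%N)%:R. Proof. by []. Qed.

Lemma fpsnCM r a n : (fpsC r * a).[^n] = r * a.[^n].
Proof.
rewrite fpsnM big_ord_recl fpsnC /= subn0 big1 ?addr0 // => i _.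
by rewrite fpsnC mul0r.
Qed.

Lemma fpsnXM a n : (fpsX * a).[^n] = if n is m.+1 then a.[^m] else 0.
Proof.
rewrite fpsnM; case: n => [|n]; first by rewrite big_ord1 fpsnX mul0r.
rewrite 2!big_ord_recl !fpsnX /= mul0r add0r mul1r subn1 big1 ?addr0 // => i _.
by rewrite fpsnX mul0r.
Qed.

Lemma fps_coef0M a b : (a * b).[^0] = a.[^0] * b.[^0].
Proof. by rewrite fpsnM big_ord1. Qed.

End FpsRing.

(** If [T] is contracting for the X-adic distance, the [n]-th coefficient of
    [T^k(0)] is stationary for [k > n]; [fps_fix T] is the limit. *)
Definition fps_fix (R : zmodType) (T : fps R -> fps R) : fps R :=
  FPS (fun n => (iter n.+1 T 0).[^n]).

Definition fps_contract (R : zmodType) (T : fps R -> fps R) :=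
  forall n a b, (forall m, (m < n)%N -> a.[^m] = b.[^m]) ->
                forall m, (m <= n)%N -> (T a).[^m] = (T b).[^m].

Section FpsFix.
Context {R : zmodType}.
Variable T : fps R -> fps R.
Hypothesis T_contract : fps_contract T.

Lemma fps_fix_unique a b : T a = a -> T b = b -> a = b.
Proof.
move=> Ta Tb; apply: fpsP => n; elim/ltn_ind: n => n IHn.
by rewrite -Ta -Tb; exact: T_contract IHn _ _.
Qed.

Lemma fps_fixE : T (fps_fix T) = fps_fix T.
Proof.
have iterS k l n : (n < k)%N -> (n < l)%N ->
    (iter k T 0).[^n] = (iter l T 0).[^n].
  elim: k l n => [//|k IHk] [//|l] n nk nl /=.
  apply: (T_contract _ (leqnn n)) => m mn.
  by apply: IHk; [exact: leq_trans mn nk | exact: leq_trans mn nl].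
apply: fpsP => n; rewrite [RHS]/fpsn /= -/(fpsn _ _).
apply: (T_contract _ (leqnn n)) => m mn.
by apply: iterS.
Qed.

End FpsFix.

Section FpsInv.
Context {R : comUnitRingType}.
Implicit Types a b : fps R.

Definition fps_unit : pred (fps R) := fun a => a.[^0] \is a GRing.unit.

(** [b = 1/a] is the fixpoint of [b = (1 - (a - a(0)) b) / a(0)]. *)
Let fps_inv_step a b : fps R :=
  fpsC (a.[^0])^-1 * (1 - (a - fpsC a.[^0]) * b).

Definition fps_inv a : fps R :=
  if fps_unit a then fps_fix (fps_inv_step a) else a.

Let fps_inv_contract a : fps_contract (fps_inv_step a).
Proof.
move=> n b c bc m mn; rewrite !fpsnCM !fpsnB !fpsnM !big_ord_recl.
rewrite !fpsnB !fpsnC /= !subrr !mul0r; congr (_ * (_ - (_ + _))).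
apply: eq_bigr => i _; congr (_ * _); apply: bc.
rewrite /bump /= add1n; apply: leq_trans mn.
by rewrite ltn_subrL /=; apply: leq_trans (ltn_ord i).
Qed.

Fact fps_mulV : {in fps_unit, left_inverse 1 fps_inv *%R}.
Proof.
move=> a ua; have ua0 : a.[^0] \is a GRing.unit by [].
rewrite /fps_inv (_ : fps_unit a) //; set b := fps_fix _.
have bE : fps_inv_step a b = b by exact/fps_fixE/fps_inv_contract.
have CV : fpsC a.[^0] * fpsC (a.[^0])^-1 = 1.
  apply: fpsP => n; rewrite fpsnCM fpsnC fpsn1.
  by case: n => [|n] /=; rewrite ?divrr ?mulr0.
have := congr1 (fun c => fpsC a.[^0] * c) bE.
rewrite /fps_inv_step mulrA CV mul1r mulrBl opprB addrA => /eqP.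
by rewrite subr_eq addrC (inj_eq (addrI _)) mulrC => /eqP.
Qed.

Fact fps_unitP a b : b * a = 1 -> fps_unit a.
Proof.
move=> /(congr1 (fun c => c.[^0])); rewrite fps_coef0M fpsn1 /= => ba1.
by apply/unitrPr; exists b.[^0]; rewrite mulrC.
Qed.

Fact fps_inv_out : {in [predC fps_unit], fps_inv =1 id}.
Proof. by move=> a na; rewrite /fps_inv ifN. Qed.

HB.instance Definition _ := GRing.ComNzRing_hasMulInverse.Build (fps R)
  fps_mulV fps_unitP fps_inv_out.

Lemma fps_unitE a : (a \is a GRing.unit) = (a.[^0] \is a GRing.unit).
Proof. by []. Qed.

End FpsInv.

(** The indeterminate [y] of Q[y] is ['X]. Division is that of the ring of power
    series; the denominator has constant coefficient 1, hence is a unit. *)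
Definition ucond (u : fps {poly rat}) : Prop :=
  u.[^0] = 0 /\ u / (1 - fpsC 'X * u - fpsC 'X * u ^+ 2) = fpsX.

Lemma ucondE (u : fps {poly rat}) :
  ucond u <-> fpsX * (1 - fpsC 'X * u - fpsC 'X * u ^+ 2) = u.
Proof.
have unitD : u.[^0] = 0 ->
    1 - fpsC 'X * u - fpsC 'X * u ^+ 2 \is a GRing.unit.
  move=> u0; rewrite fps_unitE !fpsnB !fpsnCM fpsn1 expr2 fps_coef0M u0.
  by rewrite !mulr0 !subr0 unitr1.
split=> [[u0 <-]|uE]; first by rewrite divrK ?unitD.
have u0 : u.[^0] = 0 by rewrite -uE fpsnXM.
by split=> //; rewrite -{1}uE mulrK ?unitD.
Qed.

Lemma ucond_exists_unique : exists! u, ucond u.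
Proof.
pose T (u : fps {poly rat}) :=
  fpsX * (1 - fpsC 'X * u - fpsC 'X * u ^+ 2).
have Tc : fps_contract T.
  move=> n a b ab [|m] mn; rewrite !fpsnXM // !fpsnB !fpsnCM !expr2 !fpsnM.
  rewrite ab //; congr (_ - _ * _); apply: eq_bigr => i _.
  rewrite !ab //; first exact: leq_ltn_trans (leq_subr _ _) mn.
  by apply: leq_ltn_trans mn; rewrite -ltnS.
exists (fps_fix T); split; first by apply/ucondE; exact: fps_fixE.
by move=> v /ucondE vE; apply: (fps_fix_unique Tc) => //; exact: fps_fixE.
Qed.

Definition useries : fps {poly rat} := projT1 (cid ucond_exists_unique).

Lemma useriesP : ucond useries.
Proof. by rewrite /useries; case: cid => u []. Qed.

Definition Ftilde (n : nat) : {poly rat} := useries.[^n].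

Definition pochhammer (K : fieldType) (a : K) (j : nat) : K :=
  \prod_(i < j) (a + i%:R).

(** The sum over all [j] is a finitely supported sum: this is the value of the
    series when it terminates (otherwise it is [0] by convention). *)
Definition hyp2F1 (K : fieldType) (a b c z : K) : K :=
  \sum_(j \in [set: nat])
    (pochhammer a j * pochhammer b j) / (pochhammer c j * j`!%:R) * z ^+ j.

(** Laurent polynomials in [y] are viewed inside the field Q(y), into which
    Q[y] embeds injectively by [toQy]. *)
Definition Qy : fieldType := {fraction {poly rat}}.
Definition toQy (p : {poly rat}) : Qy := FracField.tofrac p.
Definition yQ : Qy := toQy 'X.

(* Main.v *)
Require Import Defs.
From mathcomp Require Import all_boot all_order all_algebra.
From mathcomp Require Import classical_sets fsbigop ring zify.

Import GRing.Theory.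
Local Open Scope ring_scope.

(** Write [P_n(t) = sum_j C(n, 2j) Cat_j t^j], with [Cat_j] the Catalan numbers.
    Both sides of the identity equal [(-y)^n P_n(-1/y)].

    On the hypergeometric side, the product of the Pochhammer symbols at
    [(1 - n)/2] and [-n/2] is the falling factorial [n (n-1) ... (n-2j+1)]
    divided by [4^j]. Since [(2)_j j! = (j+1)! j!] and
    [Cat_j = (2j)! / (j! (j+1)!)], the [j]-th term of the series at [4t] is
    [C(n, 2j) Cat_j t^j] ([hyp2F1_motzkin]).

    On the series side, clearing the denominator gives [u = x (1 - y u - y u^2)],
    a quadratic recurrence that determines the coefficients of [u]
    ([FtildeSS]). The polynomials [P_n] satisfy the recurrence
    [P_(n+1) = P_n + t sum_(i<n) P_i P_(n-1-i)] ([motzkinS]), which turns into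
    that of [u] after the rescaling [(-y)^n P_n(-1/y)] ([homog_motzkinS]).
    This recurrence for [P_n] is Pascal's rule together with two convolutions:
    [sum_(i<n) C(i, a) C(n-1-i, b) = C(n, a+b+1)] ([sum_bin_mul_bin]), and
    Segner's recurrence for the Catalan numbers ([sum_catalan_mul]). *)

(** * Sums of products of binomial coefficients *)

(** Choosing [a + b + 1] of [n] points amounts to choosing the point [i] of rank
    [a], then [a] points before it and [b] points after it. The proof is by
    Pascal's rule on the second factor. *)
Lemma sum_bin_mul_bin (n a b : nat) :
  (\sum_(i < n) 'C(i, a) * 'C(n.-1 - i, b) = 'C(n, (a + b).+1))%N.
Proof.
elim: n b => [|n IHn] b; first by rewrite big_ord0 bin0n.
rewrite big_ord_recr /= subnn binS addnC.
have tailE c : (\sum_(i < n) 'C(i, a) * 'C(n - i, c.+1) =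
    \sum_(i < n) 'C(i, a) * 'C(n.-1 - i, c.+1) +
    \sum_(i < n) 'C(i, a) * 'C(n.-1 - i, c))%N.
  rewrite -big_split /=; apply: eq_bigr => i _; rewrite -mulnDr.
  by have ->: (n - i = (n.-1 - i).+1)%N by have := ltn_ord i; lia.
case: b => [|b]; last first.
  by rewrite tailE !IHn bin0n muln0 add0n addnS addnC.
rewrite bin0n muln1 addn0 addnC; congr (_ + _)%N.
rewrite -[in RHS](addn0 a) -IHn.
by apply: eq_bigr => i _; rewrite !bin0.
Qed.

(** * Catalan numbers *)

(** The reflection form is a natural number by construction, so that no
    divisibility has to be carried along. *)
Definition catalan (j : nat) : nat := 'C(j.*2, j) - 'C(j.*2, j.+1).

Lemma mulSn_catalan (j : nat) : (j.+1 * catalan j = 'C(j.*2, j))%N.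
Proof.
rewrite mulnBr mul_bin_left -addnn addnK mulSn.
by rewrite addnK.
Qed.

Lemma catalan_fact (j : nat) : (catalan j * (j`! * j.+1`!) = j.*2`!)%N.
Proof.
have jj : (j <= j.*2)%N by rewrite -addnn leq_addr.
rewrite -(bin_fact jj) -mulSn_catalan factS -addnn addnK.
lia.
Qed.

Lemma catalanS (j : nat) :
  (j.+2 * catalan j.+1 = (4 * j + 2) * catalan j)%N.
Proof.
have := catalan_fact j.+1; have := catalan_fact j.
have := fact_gt0 j.
rewrite doubleS !factS -muln2; move: (j * 2)`! j`! => F f f0 <- e.
apply/eqP; rewrite -(eqn_pmul2r f0) -(eqn_pmul2r f0).
rewrite -(eqn_pmul2r (ltn0Sn j)) -(eqn_pmul2r (ltn0Sn j)).
apply/eqP; nia.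
Qed.

(** Let [S_n] be the convolution. Exchanging [i] and [n - i] shows that
    weighting its terms by [i] multiplies it by [n / 2]. Weighting the terms of
    [S_(n+1)] by [i + 1] thus gives [(n + 3) / 2 * S_(n+1)]; on the other hand
    the two-term recurrence of the Catalan numbers expresses that sum through
    [S_n]. Comparing the two values yields the induction step. *)
Lemma sum_catalan_mul (n : nat) :
  (\sum_(i < n.+1) catalan i * catalan (n - i) = catalan n.+1)%N.
Proof.
elim: n => [|n IHn]; first by rewrite big_ord1.
have sym m : (2 * \sum_(i < m.+1) i * (catalan i * catalan (m - i)) =
    m * \sum_(i < m.+1) catalan i * catalan (m - i))%N.
  rewrite mul2n -addnn [X in (X + _)%N](reindex_inj rev_ord_inj) /=.
  rewrite -big_split big_distrr /=; apply: eq_bigr => i _.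
  have im : (i <= m)%N by rewrite -ltnS.
  rewrite subSS subKn // [(catalan (m - i) * _)%N]mulnC -mulnDl.
  by rewrite subnK.
have wsum : (\sum_(i < n.+2) i.+1 * (catalan i * catalan (n.+1 - i)) =
    catalan n.+1 + 2 * n.+1 * catalan n.+1)%N.
  rewrite big_ord_recl /= subn0 mul1n [catalan 0]/= mul1n; congr (_ + _)%N.
  transitivity (\sum_(i < n.+1) (4 * (i * (catalan i * catalan (n - i)))
      + 2 * (catalan i * catalan (n - i))))%N.
    apply: eq_bigr => i _; rewrite /bump /= add1n subSS.
    have := catalanS i; nia.
  rewrite big_split -!big_distrr /= IHn.
  by have := sym n; rewrite IHn; move: (bigop.body _ _ _) (catalan _) => X c; lia.
have := sym n.+1; have := catalanS n.+1; move: wsum.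
under eq_bigr => i _ do rewrite mulSn.
rewrite big_split /=; nia.
Qed.

(** * Weighted Motzkin polynomials *)

Section Motzkin.
Context {R : comNzRingType}.
Implicit Type t : R.

Definition motzkin t (n : nat) : R :=
  \sum_(j < n.+1) ('C(n, j.*2) * catalan j)%:R * t ^+ j.

(** A range of summation independent of [n] lets sums over [n] and [j] be
    exchanged. *)
Lemma motzkin_widen t n N : (n <= N)%N ->
  motzkin t n = \sum_(j < N.+1) ('C(n, j.*2) * catalan j)%:R * t ^+ j.
Proof.
move=> nN; rewrite /motzkin (big_ord_widen N.+1
  (fun j => ('C(n, j.*2) * catalan j)%:R * t ^+ j)) //.
rewrite big_mkcond; apply: eq_bigr => j _; case: ifP => // /negbT.
by rewrite -leqNgt => nj; rewrite bin_small ?mul0r //; lia.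
Qed.

(** Grouping the terms of a square of indices by antidiagonals [a + b = k]; the
    vanishing of [f] from [N] on disposes of the antidiagonals that the square
    only meets in part. *)
Lemma sum_antidiagonal (N : nat) (f g : nat -> nat) t :
  (forall k, (N <= k)%N -> f k = 0%N) ->
  \sum_(a < N) \sum_(b < N) (f (a + b)%N * (g a * g b))%:R * t ^+ (a + b) =
  \sum_(k < N) (f k * \sum_(a < k.+1) g a * g (k - a)%N)%:R * t ^+ k.
Proof.
move=> f0.
(* The substitution [b = k - a], valid on the range [a <= k < N]. *)
pose h a k : R := (f k * (g a * g (k - a)%N))%:R * t ^+ k.
transitivity (\sum_(0 <= a < N) \sum_(0 <= k < N | (a <= k)%N) h a k).
  rewrite big_mkord; apply: eq_bigr => a _.
  rewrite -(big_mkord xpredT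
    (fun b => (f (a + b)%N * (g a * g b))%:R * t ^+ (a + b))).
  rewrite (big_cat_nat (n := N - a)) ?leq_subr //=.
  rewrite [X in _ + X]big_nat_cond [X in _ + X]big1 ?addr0; last first.
    by move=> b /andP[/andP[h1 _] _]; rewrite f0 ?mul0r //; lia.
  rewrite [RHS]big_mkcond (big_cat_nat (n := a)) //=; last exact: ltnW.
  rewrite [X in _ = X + _]big_nat_cond [X in _ = X + _]big1 ?add0r; last first.
    by move=> k /andP[/andP[_ h1] _]; rewrite leqNgt h1.
  rewrite -[in RHS](add0n (a : nat)) big_addn; apply: eq_bigr => b _.
  by rewrite add0n leq_addl /h addnK addnC.
rewrite (exchange_big_dep_nat xpredT) //= big_mkord; apply: eq_bigr => k _.
rewrite -(big_mkord xpredT (fun a => g a * g (k - a))%N).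
rewrite big_distrr natr_sum big_distrl /=.
by rewrite [RHS](big_nat_widen _ _ N).
Qed.

(** The convolution of the [P_i] has [C(n, 2k + 1) Cat_(k+1)] as coefficient of
    [t^k]; shifted by [t], it accounts for the second term of Pascal's rule
    [C(n + 1, 2k + 2) = C(n, 2k + 2) + C(n, 2k + 1)]. *)
Lemma motzkinS t n :
  motzkin t n.+1 =
  motzkin t n + t * \sum_(i < n) motzkin t i * motzkin t (n.-1 - i).
Proof.
have convE : \sum_(i < n) motzkin t i * motzkin t (n.-1 - i) =
    \sum_(k < n.+1) ('C(n, k.*2.+1) * catalan k.+1)%:R * t ^+ k.
  transitivity (\sum_(i < n) \sum_(a < n.+1) \sum_(b < n.+1)
      ('C(i, a.*2) * 'C(n.-1 - i, b.*2) * (catalan a * catalan b))%:R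
        * t ^+ (a + b)).
    apply: eq_bigr => i _; have ni := ltn_ord i.
    rewrite (@motzkin_widen t i n) ?(@motzkin_widen t (n.-1 - i) n); try lia.
    rewrite big_distrlr; apply: eq_bigr => a _; apply: eq_bigr => b _ /=.
    rewrite exprD mulrACA -natrM; congr (_%:R * _); lia.
  rewrite exchange_big /=.
  under eq_bigr => a _.
    rewrite exchange_big /=.
    under eq_bigr => b _.
      rewrite -big_distrl -natr_sum -big_distrl /= sum_bin_mul_bin -doubleD.
      over.
    over.
  rewrite (@sum_antidiagonal _ (fun k => 'C(n, k.*2.+1))); last first.
    by move=> k nk; rewrite bin_small //; lia.
  by apply: eq_bigr => k _; rewrite sum_catalan_mul.
rewrite {}convE [LHS]/motzkin big_ord_recl /=.
rewrite (@motzkin_widen t n n.+1) // [in RHS]big_ord_recl /= !bin0.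
rewrite -addrA; congr (_ + _).
rewrite big_distrr -big_split /=; apply: eq_bigr => k _.
rewrite /bump /= add1n doubleS binS mulnDl natrD mulrDl; congr (_ + _).
by rewrite exprS mulrCA.
Qed.

End Motzkin.

(** The rescaled sequence satisfies the recurrence of the coefficients of [u];
    compare [FtildeSS]. *)
Lemma homog_motzkinS (K : fieldType) (y : K) (n : nat) : y != 0 ->
  let m k := (- y) ^+ k * motzkin (- y^-1) k in
  m n.+1 = - (y * (m n + \sum_(i < n) m i * m (n.-1 - i)%N)).
Proof.
move=> y0 m; have sumE : \sum_(i < n) m i * m (n.-1 - i)%N = (- y) ^+ n.-1 *
    \sum_(i < n) motzkin (- y^-1) i * motzkin (- y^-1) (n.-1 - i).
  rewrite big_distrr; apply: eq_bigr => i _ /=; have ni := ltn_ord i.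
  by rewrite /m mulrACA -exprD subnKC //; lia.
rewrite sumE /m motzkinS; case: n {sumE} => [|n];
  first by rewrite !big_ord0; ring.
move: (\sum_(i < n.+1) _) (motzkin _ _) => S M.
by rewrite !exprS; field.
Qed.

(** * Terminating hypergeometric series *)

Section Hypergeometric.
Context {K : fieldType}.
Hypothesis charK : [pchar K] =i pred0.

Let natf_neq0 n : (n.+1%:R : K) != 0.
Proof. by have /pcharf0P-> := charK. Qed.

(** Over [K] the subtraction is exact: when the truncated [n - m] would differ
    from it, the falling factorial [n ^_ m] is already zero. *)
Lemma natr_ffactSr (n m : nat) :
  (n ^_ m.+1)%:R = (n ^_ m)%:R * (n%:R - m%:R) :> K.
Proof.
rewrite ffactnSr natrM; have [mn|nm] := leqP m n; first by rewrite natrB.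
by rewrite ffact_small // !mul0r.
Qed.

(** The factors [n - 2i - 1] and [n - 2i], halved and negated, are those of the
    two Pochhammer symbols: this is the duplication formula for [(-n)_(2j)]. *)
Lemma pochhammer_half (n j : nat) :
  4 ^+ j * (pochhammer (1 / 2 - n%:R / 2) j * pochhammer (- (n%:R / 2)) j) =
  (n ^_ j.*2)%:R :> K.
Proof.
have n2 : (2 : K) != 0 := natf_neq0 1.
elim: j => [|j IHj]; first by rewrite /pochhammer !big_ord0 !mul1r.
rewrite doubleS !natr_ffactSr -IHj /pochhammer !big_ord_recr /=.
rewrite exprS -mul2n -natr1 natrM; field.
exact: n2.
Qed.

Lemma pochhammer2 (j : nat) : pochhammer 2 j = j.+1`!%:R :> K.
Proof.
elim: j => [|j IHj]; rewrite /pochhammer ?big_ord0 // big_ord_recr /=.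
by rewrite -/(pochhammer 2 j) IHj factS -natrD -natrM mulnC.
Qed.

Lemma hyp2F1_motzkin (n : nat) (t : K) :
  hyp2F1 (1 / 2 - n%:R / 2) (- (n%:R / 2)) 2 (4 * t) = motzkin t n.
Proof.
have factf_neq0 m : (m`!%:R : K) != 0.
  by case: m`! (fact_gt0 m) => // k _; exact: natf_neq0.
have termE j : (pochhammer (1 / 2 - n%:R / 2) j * pochhammer (- (n%:R / 2)) j)
    / (pochhammer 2 j * j`!%:R) * (4 * t) ^+ j =
    ('C(n, j.*2) * catalan j)%:R * t ^+ j :> K.
  rewrite exprMn mulrA; congr (_ * _).
  rewrite mulrAC [_ * 4 ^+ j]mulrC pochhammer_half pochhammer2.
  rewrite -bin_ffact -catalan_fact !natrM; field.
  by rewrite factf_neq0 nat1r natf_neq0.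
rewrite /hyp2F1 /motzkin; under eq_fsbigr => j _ do rewrite termE.
rewrite (fsbig_ord _ _ (fun j => ('C(n, j.*2) * catalan j)%:R * t ^+ j)).
apply/esym/fsbig_widen => // j [_ /= /negP]; rewrite -leqNgt => nj.
by rewrite bin_small ?mul0r //; lia.
Qed.

End Hypergeometric.

(** * The series u *)

Lemma pchar_Qy : [pchar Qy] =i pred0.
Proof.
apply/pcharf0P => n.
rewrite -(rmorph_nat (@tofrac {poly rat})) tofrac_eq0.
by rewrite -polyC_natr polyC_eq0 Num.Theory.pnatr_eq0.
Qed.

Lemma yQ_neq0 : yQ != 0.
Proof. by rewrite tofrac_eq0 polyX_eq0. Qed.

Lemma Ftilde0 : Ftilde 0 = 0.
Proof. by case: useriesP. Qed.

Lemma Ftilde1 : Ftilde 1 = 1.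
Proof.
rewrite /Ftilde; have /ucondE <- := useriesP; rewrite fpsnXM.
rewrite !fpsnB !fpsnCM expr2 fps_coef0M fpsn1.
by have -> := Ftilde0 : useries.[^0] = 0; rewrite !mulr0 !subr0.
Qed.

(** The coefficient of [x^(n+2)] in [u = x (1 - y u - y u^2)]. As [u(0) = 0], the
    two extreme terms of the convolution [u^2] vanish. *)
Lemma FtildeSS (n : nat) :
  Ftilde n.+2 =
  - ('X * (Ftilde n.+1 + \sum_(i < n) Ftilde i.+1 * Ftilde (n.-1 - i).+1)).
Proof.
rewrite {1}/Ftilde; have /ucondE {1}<- := useriesP; rewrite fpsnXM.
rewrite !fpsnB !fpsnCM fpsn1 sub0r -opprD -mulrDr; congr (- (_ * (_ + _))).
rewrite expr2 fpsnM big_ord_recl big_ord_recr /= subnn.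
have u0 : useries.[^0] = 0 := Ftilde0.
rewrite u0 mul0r mulr0 add0r addr0; apply: eq_bigr => i _.
rewrite /bump /= add1n subSS; congr (_ * Ftilde _).
by have := ltn_ord i; lia.
Qed.

Lemma toQy_Ftilde (n : nat) :
  toQy (Ftilde n.+1) = (- yQ) ^+ n * motzkin (- yQ^-1) n.
Proof.
elim/ltn_ind: n => -[|n] IHn.
  by rewrite Ftilde1 /motzkin big_ord1 !mul1r /toQy rmorph1.
have {}IHn m : (m <= n)%N ->
    tofrac (Ftilde m.+1) = (- yQ) ^+ m * motzkin (- yQ^-1) m := IHn m.
rewrite FtildeSS /toQy rmorphN rmorphM rmorphD rmorph_sum /= IHn //.
rewrite -[tofrac 'X]/yQ.
rewrite homog_motzkinS ?yQ_neq0 //; congr (- (_ * (_ + _))).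
apply: eq_bigr => i _; rewrite rmorphM /= !IHn //.
  by have := ltn_ord i; lia.
exact: ltnW.
Qed.

Theorem proposition4 (n : nat) :
  toQy (Ftilde n.+1) =
  (- yQ) ^+ n * hyp2F1 (1 / 2 - n%:R / 2) (- (n%:R / 2)) 2 (- (4 / yQ)).
Proof.
by rewrite toQy_Ftilde -[- (4 / yQ)]mulrN (hyp2F1_motzkin pchar_Qy).
Qed.
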